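(* Let $X$ be a totally disconnected, compact, metrizable topological space and let $\mathcal{G}\subset\mathrm{Homeo}(X)$ be an ample group. Suppose $Y$ is a finite nonempty subset of $X$. Then the following statements hold true. (i) If $Y$ is a proper subset of a single orbit of $\mathcal{G}$ and, moreover, $Y$ does not contain exactly half of the points in the orbit, then the stabilizer $\mathrm{St}_{\mathcal{G}}(Y)$ is a maximal subgroup of $\mathcal{G}$. (ii) If $Y$ is a subset of an orbit $\mathrm{Orb}_{\mathcal{G}}(x)$ that contains exactly half of its points, then $\mathrm{St}_{\mathcal{G}}(Y)$ is a subgroup of index $2$ in the group $\mathrm{St}_{\mathcal{G}}(Y,\mathrm{Orb}_{\mathcal{G}}(x)\setminus Y)$. The latter is a maximal subgroup of $\mathcal{G}$ unless $Y$ consists of a single point, in which case $\mathrm{St}_{\mathcal{G}}(Y,\mathrm{Orb}_{\mathcal{G}}(x)\setminus Y)=\mathcal{G}$. (iii) If there are at least two orbits of $\mathcal{G}$ that intersect $Y$ but are not contained in $Y$, then $\mathrm{St}_{\mathcal{G}}(Y)$ is a proper subgroup of $\mathcal{G}$ that is not maximal. (iv) If $Y$ is a union of orbits of $\mathcal{G}$, then $\mathrm{St}_{\mathcal{G}}(Y)=\mathcal{G}$. (v) If $Y=Y_1\sqcup Y_2$, where $Y_2$ is a union of orbits of $\mathcal{G}$, then $\mathrm{St}_{\mathcal{G}}(Y)=\mathrm{St}_{\mathcal{G}}(Y_1)$.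
   Context: $\mathrm{Homeo}(X)$ is the group of all homeomorphisms of $X$. For a group $G\subset\mathrm{Homeo}(X)$, its full amplification $\mathsf{F}(G)$ is the group of all homeomorphisms $f$ of $X$ such that every point $x\in X$ has an open neighborhood $U_x$ on which $f$ coincides with some element of $G$. The group $G$ is called ample if $\mathsf{F}(G)=G$. $\mathrm{Orb}_{\mathcal{G}}(x)=\{g(x)\mid g\in\mathcal{G}\}$. For $Y\subset X$, $\mathrm{St}_{\mathcal{G}}(Y)=\{g\in\mathcal{G}\mid g(Y)=Y\}$. For distinct sets $Y,Y'\subset X$, $\mathrm{St}_{\mathcal{G}}(Y,Y')$ consists of those $g\in\mathcal{G}$ that map each of the two sets onto one of the two sets (the same or the other). ''$Y$ contains exactly half of the points in the orbit'' means the orbit is finite and has exactly $2|Y|$ points. A maximal subgroup of $\mathcal{G}$ is a proper subgroup $H$ such that there is no subgroup $K$ with $H\subsetneq K\subsetneq\mathcal{G}$. *)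

(* Defs.v *)
From HB Require Import structures.
From mathcomp Require Import all_boot all_order all_algebra.
From mathcomp Require Import all_classical all_reals topology.

Set Implicit Arguments.
Unset Strict Implicit.
Unset Printing Implicit Defensive.

Import Order.TTheory GRing.Theory Num.Theory.

Local Open Scope classical_set_scope.
Local Open Scope card_scope.
Local Open Scope ring_scope.

Definition is_metric (R : realType) (T : Type) (d : T -> T -> R) : Prop :=
  [/\ forall x y, 0 <= d x y,
      forall x y, d x y = 0 <-> x = y,
      forall x y, d x y = d y x
    & forall x y z, d x z <= d x y + d y z].

Definition metrizable (R : realType) (X : topologicalType) : Prop :=
  exists2 d : X -> X -> R, is_metric d &
    forall x (A : set X),
      nbhs x A <-> exists2 e : R, 0 < e & [set y | d x y < e] `<=` A.

Record homeo (X : topologicalType) := Homeo {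
  homeo_fun :> X -> X;
  homeo_inv : X -> X;
  homeo_funK : cancel homeo_fun homeo_inv;
  homeo_invK : cancel homeo_inv homeo_fun;
  homeo_continuous : continuous homeo_fun;
  homeo_inv_continuous : continuous homeo_inv
}.

Section HomeoGroup.
Variable X : topologicalType.
Implicit Types f g h : homeo X.

Lemma homeo_eq f g : f =1 g -> f = g.
Proof.
case: f g => [f f' fK f'K cf cf'] [g g' gK g'K cg cg'] /= fg.
have efg : f = g by apply/funext.
have efg' : f' = g'.
  by apply/funext => x; apply: (can_inj fK); rewrite f'K fg g'K.
by subst g g'; congr Homeo; exact: Prop_irrelevance.
Qed.

HB.instance Definition _ := gen_eqMixin (homeo X).
HB.instance Definition _ := gen_choiceMixin (homeo X).

Lemma homeo_id_continuous : continuous (@id X).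
Proof. by move=> x; exact: cvg_id. Qed.

Definition homeo_id : homeo X :=
  @Homeo X id id (fun=> erefl) (fun=> erefl) homeo_id_continuous homeo_id_continuous.

Definition homeo_inverse f : homeo X :=
  Homeo (@homeo_invK X f) (@homeo_funK X f)
    (@homeo_inv_continuous X f) (@homeo_continuous X f).

Lemma homeo_comp_continuous f g : continuous (f \o g).
Proof.
move=> x; apply: continuous_comp; exact: homeo_continuous.
Qed.

Lemma homeo_comp_inv_continuous f g : continuous (homeo_inv g \o homeo_inv f).
Proof.
move=> x; apply: continuous_comp; exact: homeo_inv_continuous.
Qed.

Definition homeo_comp f g : homeo X :=
  Homeo (can_comp (@homeo_funK X f) (@homeo_funK X g))
    (can_comp (@homeo_invK X g) (@homeo_invK X f))
    (@homeo_comp_continuous f g) (@homeo_comp_inv_continuous f g).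

Lemma homeo_compA : associative homeo_comp.
Proof. by move=> f g h; exact: homeo_eq. Qed.

Lemma homeo_comp1f : left_id homeo_id homeo_comp.
Proof. by move=> f; exact: homeo_eq. Qed.

Lemma homeo_compf1 : right_id homeo_id homeo_comp.
Proof. by move=> f; exact: homeo_eq. Qed.

Lemma homeo_compVf : left_inverse homeo_id homeo_inverse homeo_comp.
Proof. by move=> f; apply: homeo_eq => x; exact: homeo_funK. Qed.

Lemma homeo_compfV : right_inverse homeo_id homeo_inverse homeo_comp.
Proof. by move=> f; apply: homeo_eq => x; exact: homeo_invK. Qed.

HB.instance Definition _ := isGroup.Build (homeo X)
  homeo_compA homeo_comp1f homeo_compf1 homeo_compVf homeo_compfV.

End HomeoGroup.

Section Subgroups.
Variable gT : groupType.
Implicit Types H K G : set gT.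

Definition is_subgroup H : Prop := group_closed (mem H).

Definition maximal_subgroup H G : Prop :=
  [/\ is_subgroup H, H `<` G
    & ~ exists K, [/\ is_subgroup K, H `<` K & K `<` G]].

(* The index is counted by left cosets. *)
Definition subgroup_of_index H G (n : nat) : Prop :=
  [/\ is_subgroup H, is_subgroup G, H `<=` G
    & [set [set (g * h)%g | h in H] | g in G] #= `I_n].

End Subgroups.

Section HomeoSubgroups.
Variable X : topologicalType.
Implicit Types (G : set (homeo X)) (Y : set X).

Definition full_amplification G : set (homeo X) :=
  [set f : homeo X | forall x : X, exists2 U : set X, open_nbhs x U &
                       exists2 g : homeo X, G g & {in U, f =1 g}].

Definition ample G : Prop := full_amplification G = G.

Definition homeo_orbit G (x : X) : set X := [set (g : homeo X) x | g in G].

Definition union_of_orbits G Y : Prop :=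
  exists A : set X, Y = \bigcup_(x in A) homeo_orbit G x.

Definition stabilizer G Y : set (homeo X) :=
  [set g : homeo X | G g /\ g @` Y = Y].

Definition stabilizer2 G Y Y' : set (homeo X) :=
  [set g : homeo X | [/\ G g, g @` Y = Y \/ g @` Y = Y'
                  & g @` Y' = Y \/ g @` Y' = Y']].

(* An infinite set O has no half. *)
Definition has_half_of Y (O : set X) : Prop :=
  exists2 n : nat, Y #= `I_n & O #= `I_(2 * n)%N.

End HomeoSubgroups.

(* Main.v *)
Require Import Defs.
From HB Require Import structures.
From mathcomp Require Import all_boot all_order all_algebra finmap.
From mathcomp Require Import all_classical all_reals topology.

(* A compact, metrizable, totally disconnected space has enough clopen sets to
   separate points, so for [x] and [y = g x] in one orbit of the ample group G
   there is a small clopen [U] around [x] such that exchanging [U] and [g @` U]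
   via [g] gives an element of G that swaps [x] and [y] and fixes any prescribed
   finite set of other points. Thus G acts highly transitively on each orbit O,
   and the rest is the classical argument for stabilizers of finite sets:
   conjugating a swap in St(Y) by an element [f] of a larger subgroup K with
   [f @` Y <> Y] yields an element of K that replaces a single point of Y; by
   conjugation K then contains all single-point replacements, hence is
   transitive on the #|Y|-subsets of O, so K = G. The swap has to exchange a
   point of [f @` Y] with a point outside it, both in Y or both outside Y; this
   fails only if O is the disjoint union of Y and [f @` Y]. *)

Set Implicit Arguments.
Unset Strict Implicit.
Unset Printing Implicit Defensive.

Import Order.TTheory GRing.Theory Num.Theory.

Local Open Scope classical_set_scope.
Local Open Scope card_scope.

(** * Separation by clopen sets *)

Lemma metrizable_hausdorff (R : realType) (X : topologicalType) :
  metrizable R X -> hausdorff_space X.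
Proof.
move=> [d [d_ge0 d_eq0 dC d_triangle] nbhsE] x y xy; apply/d_eq0.
apply: contrapT => /eqP dxy_neq0.
have dxy_gt0 : (0 < d x y / 2)%R by rewrite divr_gt0// lt0r dxy_neq0 d_ge0.
have ball_nbhs z : nbhs z [set t | d z t < d x y / 2]%R.
  by apply/nbhsE; exists (d x y / 2)%R.
have [z [xz yz]] := xy _ _ (ball_nbhs x) (ball_nbhs y).
have := le_lt_trans (d_triangle x z y) (ltrD xz _).
by rewrite (dC z y) => /(_ _ yz); rewrite -splitr ltxx.
Qed.

(* A cluster point of the trace on [~` V] of the filter of clopen
   neighbourhoods of [x] could not be separated from [x]. *)
Lemma compact_clopen_subset (X : topologicalType) (x : X) (V : set X) :
  compact [set: X] -> open V ->
  (forall y, ~ V y -> exists U : set X, [/\ clopen U, U x & ~ U y]) ->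
  exists D : set X, [/\ clopen D, D x & D `<=` V].
Proof.
move=> X_compact oV sepV; apply: contrapT => noD.
pose F := filter_from [set D : set X | D x /\ clopen D] (fun D => D `\` V).
have F_filter : Filter F.
  apply: filter_from_filter; first by exists setT; split=> //; exact: clopenT.
  move=> A B [Ax cA] [Bx cB]; exists (A `&` B).
    by split=> //; exact: clopenI.
  by move=> y [[Ay By] nVy].
have F_proper : ProperFilter F.
  apply: filter_from_proper => D [Dx cD]; apply: contrapT => DV0.
  apply: noD; exists D; split=> // y Dy; apply: contrapT => nVy.
  by apply: DV0; exists y.
have F_clopen D : D x -> clopen D -> F (D `\` V) by move=> Dx cD; exists D.
have [p [_ Fp]] := X_compact F F_proper (@filterT _ F _).
have nVp : ~ V p.
  move=> Vp; have /(Fp _ _ (F_clopen setT I (@clopenT X))) : nbhs p V.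
    exact: open_nbhs_nbhs.
  by move=> [q [[_ nVq] /nVq]].
have [U [cU Ux nUp]] := sepV p nVp.
have /(Fp _ _ (F_clopen U Ux cU)) : nbhs p (~` U).
  by apply: open_nbhs_nbhs; split=> //; exact: (clopenC _ cU).1.
by move=> [q [[Uq _]]].
Qed.

(** In a compact Hausdorff space the quasi-component [Q] of [x], the intersection of all clopen sets
    containing [x], is connected; total disconnectedness then reduces it to [x]. *)
Lemma totally_disconnected_zero_dimensional (X : topologicalType) :
  hausdorff_space X -> compact [set: X] -> totally_disconnected [set: X] ->
  zero_dimensional X.
Proof.
move=> X_hausdorff X_compact X_td x y xy; apply: contrapT => xy_nosep.
pose Q := [set z | forall U : set X, clopen U -> U x -> U z].
(* Normality gives the disjoint open neighbourhoods [U] of [E0] and the complement of [closure C] of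
   [E1], and compactness a clopen [D] around [x] inside their union. Then [D] cut by [U] is clopen,
   contains [Q] and misses [E1]. *)
have Q_separated E0 E1 : closed E0 -> closed E1 -> E0 `&` E1 = set0 ->
    Q `<=` E0 `|` E1 -> E0 x -> Q `<=` E0.
  move=> cE0 cE1 E01 QE E0x.
  have [C] : exists2 C, set_nbhs E0 C & closure C `<=` ~` E1.
    have [|C + CE1] := compact_normal X_hausdorff X_compact cE0 (t := ~` E1).
      apply/set_nbhsP; exists (~` E1); split=> //; first exact: closed_openC.
      by apply/disjoints_subset.
    by exists C.
  move=> /set_nbhsP[U [oU E0U UC]] CE1.
  have [D [cD Dx DV]] :
      exists D, [/\ clopen D, D x & D `<=` U `|` ~` closure C].
    apply: compact_clopen_subset => //.
      apply: openU => //; apply: closed_openC; exact: closed_closure.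
    move=> z nz; apply: contrapT => z_nosep; apply: nz.
    have /QE[/E0U|E1z] : Q z.
    - move=> W cW Wx; apply: contrapT => nWz; apply: z_nosep.
      by exists W.
    - by left.
    - by right=> /CE1.
  have cDU : clopen (D `&` U).
    split; first by apply: openI => //; case: cD.
    (* [D] avoids the part of [closure C] outside [U], so the intersection is also closed. *)
    have -> : D `&` U = D `&` closure C.
      apply/seteqP; split=> z [Dz] => [/UC/subset_closure//|Cz].
      by split=> //; have [] := DV _ Dz.
    by apply: closedI; [case: cD|exact: closed_closure].
  move=> z Qz; have [//|E1z] := QE _ Qz.
  have [_ /UC/subset_closure/CE1] := Qz _ cDU (conj Dx (E0U _ E0x)).
  by move=> /(_ E1z).
have Q_closed : closed Q.
  have -> : Q = \bigcap_(U in [set U | clopen U /\ U x]) U.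
    by apply/seteqP; split=> z Qz U => [[]|cU Ux]; [exact: Qz|exact: Qz].
  by apply: closed_bigI => U [[]].
have Qx : Q x by [].
have Q_connected : connected Q.
  move=> B [b Bb] [C oC BC] [C' cC' BC'].
  have cB : closed B by rewrite BC'; exact: closedI.
  have cQB : closed (Q `&` ~` C) by apply: closedI => //; exact: open_closedC.
  have BQ : B `<=` Q by rewrite BC; exact: subIsetl.
  have BQB0 : B `&` (Q `&` ~` C) = set0.
    by rewrite BC; apply/seteqP; split=> // z [[_ Cz] [_ /(_ Cz)]].
  have QB z : Q z -> (B `|` (Q `&` ~` C)) z.
    by rewrite BC => Qz; have [] := pselect (C z) => Cz; [left|right].
  apply/seteqP; split=> //.
  (* Of the two disjoint closed sets covering [Q], the one containing [x] is all of [Q]; it cannot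
     be the second, which misses [b]. *)
  have [Bx|[_ nCx]] := QB x Qx; first exact: Q_separated QB Bx.
  have /(_ b (BQ _ Bb)) : Q `<=` Q `&` ~` C.
    by apply: (Q_separated _ B) => //; [rewrite setIC|rewrite setUC].
  by move: Bb; rewrite BC => -[_ Cb] [_ /(_ Cb)].
have : Q y.
  by move=> U cU Ux; apply: contrapT => nUy; apply: xy_nosep; exists U.
move=> /(connected_component_max Qx (@subsetT _ _) Q_connected).
by rewrite X_td// => /esym/eqP; rewrite (negPf xy).
Qed.

(** * Subgroups, and homeomorphisms as group elements *)

Section Subgroup.
Variables (gT : groupType) (H : set gT).
Lemma is_subgroupP : is_subgroup H <->
  H 1%g /\ forall f g, H f -> H g -> H (f / g)%g.
Proof.
split=> -[H1 Hdiv]; split; first exact: set_mem.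
- by move=> f g Hf Hg; apply: set_mem; apply: Hdiv; apply: mem_set.
- exact: mem_set.
- by move=> f g /set_mem Hf /set_mem Hg; apply: mem_set; apply: Hdiv.
Qed.

Hypothesis H_group : is_subgroup H.

Lemma subgroup1 : H 1%g.
Proof. exact: (is_subgroupP.1 H_group).1. Qed.

Lemma subgroupV g : H g -> H g^-1%g.
Proof.
move=> Hg; rewrite -div1g; apply: (is_subgroupP.1 H_group).2 => //.
exact: subgroup1.
Qed.

Lemma subgroupM f g : H f -> H g -> H (f * g)%g.
Proof.
move=> Hf Hg; rewrite -[g]invgK; apply: (is_subgroupP.1 H_group).2 => //.
exact: subgroupV.
Qed.

End Subgroup.

Lemma homeoVK (X : topologicalType) (g : homeo X) : cancel g (g^-1)%g.
Proof. exact: homeo_funK. Qed.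

Lemma homeoKV (X : topologicalType) (g : homeo X) : cancel (g^-1)%g g.
Proof. exact: homeo_invK. Qed.

Lemma homeo_inj (X : topologicalType) (g : homeo X) : injective g.
Proof. exact: can_inj (homeoVK g). Qed.

(** * Swaps in an ample group *)

Lemma continuous_locally_homeo (X : topologicalType) (f : X -> X) :
  (forall x, exists2 U : set X, open_nbhs x U &
     exists g : homeo X, {in U, f =1 g}) ->
  continuous f.
Proof.
move=> f_loc x; have [U [oU Ux] [g fg]] := f_loc x.
rewrite /continuous_at (fg _ (mem_set Ux)).
apply: cvg_trans (@homeo_continuous _ g x).
apply: near_eq_cvg; near=> y; apply/esym/fg/mem_set.
by near: y; exact: open_nbhs_nbhs.
Unshelve. all: by end_near. Qed.

(* The homeomorphism exchanges [U] and [g @` U] via [g] and is the identity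
   elsewhere. *)
Lemma clopen_swap (X : topologicalType) (G : set (homeo X)) (g : homeo X)
    (U : set X) :
  is_subgroup G -> ample G -> G g -> clopen U -> (forall x, U x -> ~ U (g x)) ->
  exists t : homeo X, [/\ G t, forall x, U x -> t x = g x,
    forall x, U x -> t (g x) = x &
    forall x, ~ U x -> ~ U ((g^-1)%g x) -> t x = x].
Proof.
move=> G_group G_ample Gg cU gU.
(* [U] and its image under [g] are disjoint by hypothesis, so the order of the two tests is
   immaterial and [f] is an involution. *)
pose f x := if x \in U then g x else
  if (g^-1)%g x \in U then (g^-1)%g x else x.
have f1 x : U x -> f x = g x by move=> Ux; rewrite /f mem_set.
have f2 x : U x -> f (g x) = x.
  by move=> Ux; rewrite /f homeoVK (mem_set Ux) memNset//; exact: gU.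
have f3 x : ~ U x -> ~ U ((g^-1)%g x) -> f x = x.
  by move=> nUx nUgx; rewrite /f !memNset.
have f_cases x : [\/ U x, U ((g^-1)%g x) | ~ U x /\ ~ U ((g^-1)%g x)].
  have [?|nUx] := pselect (U x); first exact: Or31.
  by have [?|nUgx] := pselect (U ((g^-1)%g x)); [exact: Or32|exact: Or33].
have fK : involutive f.
  move=> x; have [Ux|Ux|[nUx nUgx]] := f_cases x; first by rewrite (f1 x)// f2.
    by rewrite -(homeoKV g x) f2// f1.
  by rewrite (f3 x)// f3.
have cgU : clopen ((g^-1)%g @^-1` U).
  by apply: preimage_clopen => //; exact: homeo_continuous.
(* The cases correspond to clopen pieces on which [f] is [g], its inverse or the identity. This
   yields both continuity and, by ampleness, membership in [G]. *)
have f_amp x : exists2 V : set X, open_nbhs x V &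
    exists2 h : homeo X, G h & {in V, f =1 h}.
  have [Ux|Ux|[nUx nUgx]] := f_cases x.
  - exists U; first by split=> //; case: cU.
    by exists g => // y /set_mem/f1.
  - exists ((g^-1)%g @^-1` U); first by split=> //; case: cgU.
    exists (g^-1)%g; first exact: subgroupV.
    by move=> y /set_mem Uy; rewrite -{1}(homeoKV g y) f2.
  - exists (~` U `&` ~` ((g^-1)%g @^-1` U)).
      by split=> //; apply: openI; apply: closed_openC; [case: cU|case: cgU].
    exists 1%g; first exact: subgroup1.
    by move=> y /set_mem[nUy nUgy]; rewrite f3.
have f_cont : continuous f.
  apply: continuous_locally_homeo => x; have [V Vx [h _ fh]] := f_amp x.
  by exists V => //; exists h.
exists (Homeo fK fK f_cont f_cont); split=> //.
by rewrite -G_ample => x; exact: f_amp.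
Qed.

(** [t] is prescribed only on [x], [y] and the finite set [F], since a transposition of two points
    is in general not continuous. [F] may leave [O], so that a swap in one orbit can respect points
    of another. *)
Definition has_swaps (X : topologicalType) (G : set (homeo X)) (O : set X) :=
  forall (x y : X) (F : set X), O x -> O y -> finite_set F ->
  exists t : homeo X, [/\ G t, t x = y, t y = x &
    forall z, F z -> z <> x -> z <> y -> t z = z].

Lemma orbit_has_swaps (X : topologicalType) (G : set (homeo X)) (x0 : X) :
  hausdorff_space X -> compact [set: X] -> zero_dimensional X ->
  is_subgroup G -> ample G -> has_swaps G (homeo_orbit G x0).
Proof.
move=> X_hausdorff X_compact X_zd G_group G_ample x y F.
move=> [f Gf fx0] [h Gh hx0] F_finite.
have [<-|/eqP xy] := pselect (x = y).
  by exists 1%g; split=> //; exact: subgroup1.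
have [g Gg gx] : exists2 g : homeo X, G g & g x = y.
  exists (h * f^-1)%g; first by apply: subgroupM => //; exact: subgroupV.
  by rewrite -fx0 -hx0 /= homeo_funK.
(* The points that [U] has to avoid: those of [F], and those that [g] sends into [F] away from [y].
   The point [x] itself must stay available. *)
pose F' := (F `|` (g^-1)%g @` (F `\` [set y])) `\` [set x].
have F'_finite : finite_set F'.
  apply: finite_setD; rewrite finite_setU; split=> //.
  by apply: finite_image; exact: finite_setD.
have [V [cV Vx VF]] : exists V, [/\ clopen V, V x & V `<=` ~` F'].
  apply: compact_clopen_subset => //.
    apply: closed_openC; apply: (iffLR accessible_finite_set_closed) F'_finite.
    exact: hausdorff_accessible.
  move=> z /contrapT[_ zx]; apply: X_zd.
  by apply: contra_notN zx => /eqP ->.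
(* Points of [U] will lie in [W] and be sent outside [W], which makes [U] disjoint from its image
   under [g]. *)
have [W [cW Wx nWy]] := X_zd _ _ xy.
have cgW : clopen (g @^-1` ~` W).
  by apply: preimage_clopen; [exact: clopenC|exact: homeo_continuous].
pose U := V `&` (W `&` g @^-1` ~` W).
have cU : clopen U by do 2?apply: clopenI.
have Ux : U x by split=> //; split=> //=; rewrite gx.
have gU z : U z -> ~ U (g z) by move=> [_ [_ nWgz]] [_ [/nWgz]].
have [t [Gt t1 t2 t3]] := clopen_swap G_group G_ample Gg cU gU.
exists t; split=> //; first by rewrite t1.
  by rewrite -gx t2.
move=> z Fz zx zy; apply: t3 => -[/VF nF'z _]; apply: nF'z; split=> //.
- by left.
- by right; exists z.
by move=> /= gzx; apply: zy; rewrite -gx -gzx homeoKV.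
Qed.

(** * Finite sets: counting, and images under homeomorphisms *)

Lemma finite_subset_card_eq (T : choiceType) (A B : set T) :
  finite_set B -> A `<=` B -> A #= B -> A = B.
Proof.
move=> B_finite AB; have A_finite := sub_finite_set AB B_finite.
move=> /(fcard_eq A_finite B_finite) cardAB.
apply: fset_set_inj => //; apply/eqP; rewrite eqEfcard cardAB leqnn andbT.
by rewrite -fset_set_sub.
Qed.

Lemma setD_half (X : topologicalType) (Y O : set X) :
  Y `<=` O -> has_half_of Y O -> O `\` Y #= Y.
Proof.
move=> YO [n Yn On].
have O_finite : finite_set O by apply/finite_setP; exists (2 * n)%N.
have Y_finite := sub_finite_set YO O_finite.
apply/(fcard_eq (finite_setD _ O_finite) Y_finite).
rewrite fset_setD// cardfsDS -?fset_set_sub//.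
by rewrite (card_fset_set Yn) (card_fset_set On) mul2n -addnn addnK.
Qed.

(** With [Z] an image of [Y] disjoint from it and filling the rest of an orbit, this produces the
    half-orbit case that statement (i) excludes. *)
Lemma has_half_ofU (X : topologicalType) (Y Z : set X) :
  finite_set Y -> Z #= Y -> Y `&` Z = set0 -> has_half_of Y (Y `|` Z).
Proof.
move=> Y_finite ZY YZ0; have [n Yn] := iffLR (finite_setP Y) Y_finite.
have Z_finite : finite_set Z by rewrite (eq_finite_set ZY).
have YZ_finite : finite_set (Y `|` Z) by rewrite finite_setU.
exists n => //; rewrite -(fset_setK YZ_finite); apply/card_eq_fsetP.
rewrite fset_setU// cardfsU -fset_setI// YZ0 fset_set0 cardfs0 subn0.
by rewrite (fcard_eq Z_finite Y_finite ZY) (card_fset_set Yn) addnn mul2n.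
Qed.

Lemma image_homeoM (X : topologicalType) (f g : homeo X) (Z : set X) :
  (f * g)%g @` Z = f @` (g @` Z).
Proof. by rewrite image_comp. Qed.

Lemma image_homeoK (X : topologicalType) (g : homeo X) (Z : set X) :
  (g^-1)%g @` (g @` Z) = Z.
Proof. by rewrite -image_homeoM mulVg image_id. Qed.

Lemma card_image_homeo (X : topologicalType) (g : homeo X) (Z : set X) :
  g @` Z #= Z.
Proof. by apply: inj_card_eq => x y _ _; exact: homeo_inj. Qed.

Lemma image_homeoD (X : topologicalType) (g : homeo X) (Y Z : set X) :
  g @` (Y `\` Z) = g @` Y `\` g @` Z.
Proof.
apply/seteqP; split=> [_ [z [Yz nZz] <-]|_ [[z Yz <-] nZz]].
  by split; [exists z|move=> [w Zw /homeo_inj wz]; rewrite wz in Zw].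
by exists z => //; split=> // Zz; apply: nZz; exists z.
Qed.

(** Replacing a point is encoded as removing one point and adjoining another. Homeomorphisms
    transport replacements, which is what makes conjugating them useful. *)
Lemma image_homeo_replace (X : topologicalType) (g : homeo X) (Z : set X)
    (a b : X) :
  g @` (b |` (Z `\ a)) = g b |` ((g @` Z) `\ g a).
Proof.
rewrite image_setU image_set1; congr (_ `|` _).
apply/seteqP; split=> [_ [z [Zz za] <-]|_ [[z Zz <-] ga]].
  by split; [exists z|move=> /homeo_inj].
by exists z => //; split=> // za; apply: ga; rewrite za.
Qed.

Lemma image_swap (X : topologicalType) (t : homeo X) (Z : set X) (a b : X) :
  t a = b -> Z a -> ~ Z b ->
  (forall z, Z z -> z <> a -> z <> b -> t z = z) ->
  t @` Z = b |` (Z `\ a).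
Proof.
move=> tab Za nZb tZ; apply/seteqP; split=> [_ [z Zz <-]|z].
  have [->|za] := pselect (z = a); first by left.
  have zb : z <> b by move=> zb; apply: nZb; rewrite -zb.
  by rewrite tZ//; right.
move=> [->|[Zz za]]; first by exists a.
by exists z => //; apply: tZ => // zb; apply: nZb; rewrite -zb.
Qed.

(** Here [t] restricts to an involution of [Z], which gives both inclusions. This is how swaps are
    shown to stabilize a set. *)
Lemma image_swap_id (X : topologicalType) (t : homeo X) (Z : set X) (a b : X) :
  t a = b -> t b = a -> (Z a <-> Z b) ->
  (forall z, Z z -> z <> a -> z <> b -> t z = z) ->
  t @` Z = Z.
Proof.
move=> tab tba Zab tZ; have tZZ z : Z z -> Z (t z) /\ t (t z) = z.
  move=> Zz; have [za|za] := pselect (z = a).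
    by rewrite za tab tba; split=> //; apply/Zab; rewrite -za.
  have [zb|zb] := pselect (z = b).
    by rewrite zb tba tab; split=> //; apply/Zab; rewrite -zb.
  by rewrite !tZ.
apply/seteqP; split=> [_ [z /tZZ[Zz _] <-]//|z /tZZ[Zz ttz]].
by exists (t z).
Qed.

(** * Stabilizers and the invariance of orbits *)

Section Stabilizer.
Variables (X : topologicalType) (G : set (homeo X)).
Hypothesis G_group : is_subgroup G.
Implicit Types Y Z : set X.

Lemma stabilizer_subgroup Y : is_subgroup (stabilizer G Y).
Proof.
apply/is_subgroupP; split; first by split; [exact: subgroup1|rewrite image_id].
move=> f g [Gf fY] [Gg gY]; split.
  by apply: subgroupM => //; exact: subgroupV.
by rewrite image_homeoM -{1}gY image_homeoK.
Qed.

Lemma stabilizer_sub Y : stabilizer G Y `<=` G.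
Proof. by move=> g []. Qed.

Lemma image_homeo_orbit g x : G g -> g @` homeo_orbit G x = homeo_orbit G x.
Proof.
move=> Gg; apply/seteqP; split=> [_ [_ [f Gf <-] <-]|_ [f Gf <-]].
  by exists (g * f)%g => //; exact: subgroupM.
exists ((g^-1 * f)%g x); last exact: homeo_invK.
by exists (g^-1 * f)%g => //; apply: subgroupM => //; exact: subgroupV.
Qed.

Lemma image_sub_orbit g x Z :
  G g -> Z `<=` homeo_orbit G x -> g @` Z `<=` homeo_orbit G x.
Proof.
by move=> Gg ZO; rewrite -(image_homeo_orbit x Gg); exact: image_subset.
Qed.

Lemma image_union_of_orbits g Y : union_of_orbits G Y -> G g -> g @` Y = Y.
Proof.
move=> [A ->] Gg; rewrite image_bigcup.
by apply: eq_bigcupr => x _; exact: image_homeo_orbit.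
Qed.

End Stabilizer.

(** * Groups [K] between the stabilizer of [Y] and [G] *)

Section Transitivity.
Variables (X : topologicalType) (G K : set (homeo X)) (O Y : set X).
Hypotheses (G_group : is_subgroup G) (K_group : is_subgroup K).
Hypotheses (O_swaps : has_swaps G O) (GO : forall g, G g -> g @` O = O).
Hypotheses (Y_finite : finite_set Y) (YO : Y `<=` O).
Hypotheses (K_stab : stabilizer G Y `<=` K) (KG : K `<=` G).

Lemma replacement_transitive :
  (forall y y', Y y -> O y' -> ~ Y y' ->
     exists2 k : homeo X, K k & k @` Y = y' |` (Y `\ y)) ->
  forall Z, Z `<=` O -> Z #= Y -> exists2 k : homeo X, K k & k @` Y = Z.
Proof.
move=> replaceY Z; have [n] := ubnP #|` fset_set (Y `\` Z)|.
elim: n Z => // n IHn Z YZn ZO ZY.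
have Z_finite : finite_set Z by rewrite (eq_finite_set ZY).
have [YZ|/nonsubset[y [Yy nZy]]] := pselect (Y `<=` Z).
  exists 1%g; first exact: subgroup1.
  by rewrite image_id; apply: finite_subset_card_eq => //; rewrite card_eq_sym.
have /nonsubset[y' [Zy' nYy']] : ~ (Z `<=` Y).
  by move=> /(finite_subset_card_eq Y_finite)/(_ ZY) ZY'; rewrite ZY' in nZy.
have YZ_finite : finite_set (Y `|` Z) by rewrite finite_setU.
have [t [Gt ty ty' tid]] := O_swaps (YO Yy) (ZO _ Zy') YZ_finite.
have [k Kk kY] := replaceY _ _ Yy (ZO _ Zy') nYy'.
(* [k] and [t] have the same effect on [Y], so they differ by an element of its stabilizer. *)
have Kt : K t.
  have -> : t = (k * (k^-1 * t))%g by rewrite mulVKg.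
  apply: subgroupM => //; apply: K_stab; split.
    by apply: subgroupM => //; apply: subgroupV => //; exact: KG.
  rewrite image_homeoM (image_swap ty Yy nYy') -?kY ?image_homeoK//.
  by move=> z Yz; apply: tid; left.
have tZ : t @` Z = y |` (Z `\ y').
  by apply: image_swap => // z Zz zy' zy; apply: tid => //; right.
have [|||k1 Kk1 k1Y] := IHn (t @` Z).
- rewrite ltnS in YZn; apply: leq_trans YZn.
  (* Exactly one missing point, [y], has been recovered. *)
  have -> : Y `\` t @` Z = (Y `\` Z) `\ y.
    rewrite tZ; apply/seteqP; split=> z.
      move=> [Yz nz]; split; first split=> // Zz.
        apply: nz; right; split=> // zy'.
        by apply: nYy'; rewrite -zy'.
      by move=> zy; apply: nz; left.
    by move=> [[Yz nZz] zy]; split=> // -[|[]].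
  rewrite fset_setD1; last exact: finite_setD.
  rewrite [X in (_ < X)%N](cardfsD1 y) in_fset_set; last exact: finite_setD.
  by rewrite mem_set.
- by rewrite -(GO Gt); exact: image_subset.
- by rewrite (card_eql (card_image_homeo t Z)).
exists (t^-1 * k1)%g; first by apply: subgroupM => //; exact: subgroupV.
by rewrite image_homeoM k1Y image_homeoK.
Qed.

(* Conjugation by products of swaps lying in the stabilizer carries one
   replacement of a point of [Y] to every other one. *)
Lemma replacement_generates k a b :
  K k -> Y a -> O b -> ~ Y b -> k @` Y = b |` (Y `\ a) -> K = G.
Proof.
move=> Kk Ya Ob nYb kY; apply/seteqP; split=> // g Gg.
have neqY u v : Y u -> ~ Y v -> u <> v by move=> Yu nYv uv; rewrite uv in Yu.
have neqY' u v : Y u -> ~ Y v -> v <> u by move=> Yu nYv /esym; exact: neqY.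
(* An [h] in [K] with the same effect on [Y] as [g] suffices: the quotient of the two stabilizes [Y]
   and so lies in [K]. *)
have [|||h Kh hgY] := @replacement_transitive _ (g @` Y).
- move=> y y' Yy Oy' nYy'.
  have F_finite : finite_set (Y `|` [set b; y']).
    by rewrite finite_setU; split=> //; exact: finite_set2.
  (* [s] exchanges points of [Y] and [t] points outside it, so both preserve [Y]; their product
     carries [a], [b] to [y], [y']. *)
  have [s [Gs sa sy sid]] := O_swaps (YO Ya) (YO Yy) F_finite.
  have [t [Gt tb ty' tid]] := O_swaps Ob Oy' F_finite.
  have sY : s @` Y = Y.
    by apply: (image_swap_id sa sy) => // z Yz; apply: sid; left.
  have tY : t @` Y = Y.
    by apply: (image_swap_id tb ty') => // z Yz; apply: tid; left.
  have [u [Gu uY ua ub]] : exists u : homeo X,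
      [/\ G u, u @` Y = Y, u a = y & u b = y'].
    exists (t * s)%g; split; first exact: subgroupM.
    - by rewrite image_homeoM sY tY.
    - by rewrite /= sa; apply: tid; [left|exact: neqY|exact: neqY].
    - have sb : s b = b by apply: sid; [right; left|exact: neqY'|exact: neqY'].
      by rewrite /= sb.
  have Ku : K u by exact: K_stab.
  (* Since [u] preserves [Y], the conjugate replaces [u a] by [u b] in [Y]. *)
  exists (u * (k * u^-1))%g.
    by do 2?apply: subgroupM => //; exact: subgroupV.
  by rewrite !image_homeoM -{1}uY image_homeoK kY image_homeo_replace uY ua ub.
- by rewrite -(GO Gg); exact: image_subset.
- exact: card_image_homeo.
have -> : g = (h * (h^-1 * g))%g by rewrite mulVKg.
apply: subgroupM => //; apply: K_stab; split.
  by apply: subgroupM => //; apply: subgroupV => //; exact: KG.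
by rewrite image_homeoM -hgY image_homeoK.
Qed.

Lemma overgroup_stabilizer f :
  K f -> f @` Y <> Y ->
  f @` Y `&` Y !=set0 \/ ~ (O `<=` Y `|` f @` Y) -> K = G.
Proof.
move=> Kf fY H; have Gf := KG Kf.
have fYO : f @` Y `<=` O by rewrite -(GO Gf); exact: image_subset.
have fY_finite : finite_set (f @` Y) by exact: finite_image.
have [a [b [fYa Ob nfYb Yab]]] : exists a b,
    [/\ (f @` Y) a, O b, ~ (f @` Y) b & (Y a <-> Y b)].
  have YfY : ~ (Y `<=` f @` Y).
    move=> /(finite_subset_card_eq fY_finite) YfY; apply/fY/esym/YfY.
    by rewrite card_eq_sym; exact: card_image_homeo.
  (* A point common to [Y] and its image pairs with a point of [Y] outside the image; a point of [O]
     outside both sets pairs with a point of the image outside [Y]. *)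
  case: H => [[a [fYa Ya]]|/nonsubset[b [Ob /not_orP[nYb nfYb]]]].
    have [b [Yb nfYb]] := nonsubset YfY.
    by exists a, b; split=> //; exact: YO.
  have [|a [fYa nYa]] := @nonsubset _ (f @` Y) Y.
    move=> /(finite_subset_card_eq Y_finite) fYY; apply: fY; apply: fYY.
    exact: card_image_homeo.
  by exists a, b.
have F_finite : finite_set (Y `|` f @` Y) by rewrite finite_setU.
have [t [Gt ta tb tid]] := O_swaps (fYO _ fYa) Ob F_finite.
have Kt : K t.
  apply: K_stab; split=> //; apply: (image_swap_id ta tb) => // z Yz.
  by apply: tid; left.
case: (fYa) => a' Ya' fa'.
(* [t] preserves [Y] but replaces a point of its image under [f]; conjugation by [f] turns this into
   a replacement in [Y] itself. *)
apply: (@replacement_generates (f^-1 * (t * f))%g a' ((f^-1)%g b)) => //.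
- by do 2?apply: subgroupM => //; exact: subgroupV.
- rewrite -(GO (subgroupV G_group Gf)); exact: imageP.
- by move=> Yfb; apply: nfYb; exists ((f^-1)%g b) => //; exact: homeoKV.
rewrite !image_homeoM (image_swap ta)//; last first.
  by move=> z fYz; apply: tid; right.
by rewrite image_homeo_replace image_homeoK -fa' homeoVK.
Qed.

End Transitivity.

(** * Maximality, intermediate subgroups and invariant sets *)

Section Maximality.
Variables (X : topologicalType) (G : set (homeo X)).
Hypotheses (G_group : is_subgroup G).
Hypothesis G_swaps : forall x, has_swaps G (homeo_orbit G x).
Implicit Types (x : X) (Y : set X).

(** A swap along the orbit carries a point of [Y] out of [Y]. *)
Lemma stabilizer_proper x Y :
  homeo_orbit G x `&` Y !=set0 -> ~ (homeo_orbit G x `<=` Y) ->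
  stabilizer G Y `<` G.
Proof.
move=> [y [Oy Yy]] /nonsubset[y' [Oy' nYy']].
split=> [|GY]; first exact: stabilizer_sub.
have [t [Gt ty _ _]] := G_swaps Oy Oy' (finite_set0 X).
by have [_ tY] := GY _ Gt; apply: nYy'; rewrite -tY -ty; exact: imageP.
Qed.

Lemma stabilizer_maximal x Y :
  finite_set Y -> Y !=set0 -> Y `<` homeo_orbit G x ->
  ~ has_half_of Y (homeo_orbit G x) -> maximal_subgroup (stabilizer G Y) G.
Proof.
move=> Y_finite [y Yy] [YO nOY] nhalf; split.
- exact: stabilizer_subgroup.
- by apply: (@stabilizer_proper x) => //; exists y; split=> //; exact: YO.
move=> [K [K_group [stK /nonsubset[f [Kf nstf]]] [KG]]].
have fY : f @` Y <> Y by move=> fY; apply: nstf; split=> //; exact: KG.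
suff -> : K = G by apply.
apply: (overgroup_stabilizer G_group K_group (@G_swaps x) _ Y_finite YO stK KG
  Kf fY).
  by move=> g; exact: image_homeo_orbit.
(* A disjoint image covering the orbit together with [Y] would make [Y] half of it. *)
have [fYY|fYY] := pselect (f @` Y `&` Y !=set0); [by left|right=> OYfY].
apply: nhalf; have <- : Y `|` f @` Y = homeo_orbit G x.
  apply/seteqP; split=> // z [/YO//|].
  exact: image_sub_orbit (KG _ Kf) YO z.
apply: has_half_ofU => //; first exact: card_image_homeo.
by rewrite setIC; apply: contrapT => /eqP/set0P.
Qed.

Lemma stabilizer_union_of_orbits Y : union_of_orbits G Y -> stabilizer G Y = G.
Proof.
move=> YU; apply/seteqP; split=> [|g Gg]; first exact: stabilizer_sub.
by split=> //; exact: (image_union_of_orbits G_group).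
Qed.

Lemma stabilizer_setU_orbits (Y1 Y2 : set X) :
  Y1 `&` Y2 = set0 -> union_of_orbits G Y2 ->
  stabilizer G (Y1 `|` Y2) = stabilizer G Y1.
Proof.
move=> Y12 Y2U; apply/seteqP; split=> g [Gg gY]; split=> //.
  (* [Y1] is recovered from the union by removing [Y2], which every element of [G] preserves. *)
  have Y1E : Y1 = (Y1 `|` Y2) `\` Y2.
    by rewrite setDUl setDv setU0; apply/esym/setDidPl.
  by rewrite {1}Y1E image_homeoD gY (image_union_of_orbits G_group)// -Y1E.
by rewrite image_setU gY (image_union_of_orbits G_group).
Qed.

(** The stabilizer of the part of [Y] in [O1] lies strictly between: it contains swaps along [O2]
    that do not preserve [Y], yet some swap along [O1] is not in it. *)
Lemma stabilizer_not_maximal x1 x2 Y :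
  finite_set Y -> homeo_orbit G x1 <> homeo_orbit G x2 ->
  homeo_orbit G x1 `&` Y !=set0 -> ~ (homeo_orbit G x1 `<=` Y) ->
  homeo_orbit G x2 `&` Y !=set0 -> ~ (homeo_orbit G x2 `<=` Y) ->
  ~ maximal_subgroup (stabilizer G Y) G.
Proof.
set O1 := homeo_orbit G x1; set O2 := homeo_orbit G x2.
move=> Y_finite O12 O1Y nO1Y [y [O2y Yy]] /nonsubset[y' [O2y' nYy']] [_ _].
have O12_disj z : O1 z -> O2 z -> False.
  move=> [f1 Gf1 f1x] [f2 Gf2 f2x]; apply: O12.
  rewrite /O1 /O2; apply/seteqP; split=> _ [g Gg <-].
    exists (g * (f1^-1 * f2))%g.
      by do 2?apply: subgroupM => //; exact: subgroupV.
    by rewrite /= f2x -f1x homeo_funK.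
  exists (g * (f2^-1 * f1))%g.
    by do 2?apply: subgroupM => //; exact: subgroupV.
  by rewrite /= f1x -f2x homeo_funK.
apply; exists (stabilizer G (Y `&` O1)); split.
- exact: stabilizer_subgroup.
- split.
    move=> g [Gg gY]; split=> //; rewrite -[X in _ = X `&` _]gY.
    rewrite -[X in _ = _ `&` X](_ : g @` O1 = O1); last first.
      exact: image_homeo_orbit.
    apply/seteqP; split=> [_ [z [Yz Oz] <-]|_ [[z Yz <-] [w Ow /homeo_inj wz]]].
      by split; exact: imageP.
    by rewrite wz in Ow; exists z.
  (* Taking [Y] as the finite set makes [t] fix the points of [Y] in [O1], while it moves [y] out of
     [Y]. *)
  have [t [Gt ty ty' tid]] := G_swaps O2y O2y' Y_finite.
  have tst : stabilizer G (Y `&` O1) t.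
    split=> //; apply: (image_swap_id ty ty'); last first.
      by move=> z [Yz _]; exact: tid.
    by split=> -[_ /O12_disj] => [/(_ O2y)|/(_ O2y')].
  by move=> /(_ t tst)[_ tY]; apply: nYy'; rewrite -tY -ty; exact: imageP.
apply: (@stabilizer_proper x1); first by case: O1Y => z [Oz Yz]; exists z.
by move=> OY; apply: nO1Y => z /OY[].
Qed.

End Maximality.

(** * Sets containing half of an orbit *)

Section Half.
Variables (X : topologicalType) (G : set (homeo X)) (x : X) (Y : set X).
Hypotheses (G_group : is_subgroup G).
Let O := homeo_orbit G x.
Let Y' := O `\` Y.
Hypothesis O_swaps : has_swaps G O.
Hypotheses (Y_finite : finite_set Y) (Y_nonempty : Y !=set0).
Hypotheses (YO : Y `<=` O) (Y_half : has_half_of Y O).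

Let Y'_card : Y' #= Y.
Proof. exact: setD_half. Qed.

Let imageY' g : G g -> g @` Y' = O `\` g @` Y.
Proof. by move=> Gg; rewrite image_homeoD image_homeo_orbit. Qed.

Let Y'C : O `\` Y' = Y.
Proof. by rewrite setDD setIidr. Qed.

Let YY' : Y <> Y'.
Proof.
by case: Y_nonempty => y Yy YY'; have := Yy; rewrite YY' => -[_ /(_ Yy)].
Qed.

(** [g] preserves the orbit, so the image of the complement [Y'] is determined by that of [Y]. *)
Lemma stabilizer2E g :
  stabilizer2 G Y Y' g <-> G g /\ (g @` Y = Y \/ g @` Y = Y').
Proof.
split=> [[]//|[Gg gY]]; split=> //; rewrite imageY'//.
by case: gY => ->; [right|left].
Qed.

Lemma stabilizer2_subgroup : is_subgroup (stabilizer2 G Y Y').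
Proof.
apply/is_subgroupP; split.
  by apply/stabilizer2E; split; [exact: subgroup1|left; rewrite image_id].
move=> f g [Gf fY fY'] [Gg gY gY']; apply/stabilizer2E; split.
  by apply: subgroupM => //; exact: subgroupV.
rewrite image_homeoM; case: gY => gY.
  by have -> : (g^-1)%g @` Y = Y by rewrite -{1}gY image_homeoK.
case: gY' => gY'.
  by have -> : (g^-1)%g @` Y = Y' by rewrite -{1}gY' image_homeoK.
(* [g] cannot send both halves onto [Y'], since they differ. *)
by case: YY'; rewrite -(image_homeoK g Y) gY -gY' image_homeoK.
Qed.

Lemma stabilizer2_maximal :
  ~ (exists y, Y = [set y]) -> maximal_subgroup (stabilizer2 G Y Y') G.
Proof.
move=> Y_not1; have [y Yy] := Y_nonempty.
have [y' Y'y'] : Y' !=set0.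
  apply/set0P/eqP => Y'0; have := Y'_card; rewrite Y'0 card_eq_sym card_eq0.
  by move=> /eqP Y0; rewrite Y0 in Yy.
split; first exact: stabilizer2_subgroup.
- split; first by move=> g [].
  (* With a second point [y2] of [Y] fixed, the swap of [y] and [y'] gives an image of [Y] meeting
     both halves, hence equal to neither. *)
  have [y2 [Yy2 y2y]] : exists y2, Y y2 /\ y2 <> y.
    apply: contrapT => noy2; apply: Y_not1; exists y.
    apply/seteqP; split=> [z Yz|_ ->//]; apply: contrapT => zy.
    by apply: noy2; exists z.
  have [t [Gt ty _ tid]] := O_swaps (YO Yy) Y'y'.1 Y_finite.
  have ty2 : t y2 = y2.
    by apply: tid => // y2y'; rewrite y2y' in Yy2; case: Y'y'.
  move=> /(_ t Gt)/stabilizer2E[_ [tY|tY]].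
    by case: Y'y' => _; apply; rewrite -tY -ty; exact: imageP.
  have : Y' y2 by rewrite -tY -ty2; exact: imageP.
  by case.
move=> [K [K_group [stK /nonsubset[f [Kf nstf]]] [KG]]].
have Gf := KG _ Kf.
have fY : f @` Y <> Y by move=> fY; apply/nstf/stabilizer2E; split=> //; left.
suff -> : K = G by apply.
apply: (overgroup_stabilizer G_group K_group O_swaps _ Y_finite YO _ KG Kf fY).
- by move=> g; exact: image_homeo_orbit.
- by move=> g [Gg gY]; apply/stK/stabilizer2E; split=> //; left.
(* An image disjoint from [Y] would lie in [Y'] and equal it by cardinality, putting [f] in the
   smaller group. *)
left; apply: contrapT => fYY; apply/nstf/stabilizer2E; split=> //; right.
apply: finite_subset_card_eq.
- by rewrite (eq_finite_set Y'_card).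
- move=> z fYz; split; first exact: image_sub_orbit Gf YO z fYz.
  by move=> Yz; apply: fYY; exists z.
by rewrite (card_eql (card_image_homeo f Y)) card_eq_sym.
Qed.

(** [Y'] is then a single point as well, so [g] sends [Y] onto one of the two halves. *)
Lemma stabilizer2_singleton y : Y = [set y] -> stabilizer2 G Y Y' = G.
Proof.
move=> Yy; apply/seteqP; split=> [g []//|g Gg]; apply/stabilizer2E; split=> //.
have [gY|gY] := pselect (Y (g y)); [left|right].
  by rewrite {1}Yy image_set1 Yy; congr [set _]; rewrite Yy in gY.
apply: finite_subset_card_eq.
- by rewrite (eq_finite_set Y'_card).
- move=> z gYz; split; first exact: image_sub_orbit Gg YO z gYz.
  by move: gYz; rewrite {1}Yy image_set1 => ->.
by rewrite (card_eql (card_image_homeo g Y)) card_eq_sym.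
Qed.

(** Left cosets of the stabilizer correspond to the possible images of [Y], here [Y] and [Y']; [C Z]
    is the coset attached to the image [Z]. *)
Lemma stabilizer_index2 :
  subgroup_of_index (stabilizer G Y) (stabilizer2 G Y Y') 2.
Proof.
split; [exact: stabilizer_subgroup|exact: stabilizer2_subgroup| |].
  by move=> g [Gg gY]; apply/stabilizer2E; split=> //; left.
pose C Z := [set k : homeo X | G k /\ k @` Y = Z].
have cosetE g : G g -> [set (g * h)%g | h in stabilizer G Y] = C (g @` Y).
  move=> Gg; apply/seteqP; split=> [_ [h [Gh hY] <-]|k [Gk kY]].
    by split; [exact: subgroupM|rewrite image_homeoM hY].
  exists (g^-1 * k)%g; last by rewrite mulVKg.
  split; last by rewrite image_homeoM kY image_homeoK.
  by apply: subgroupM => //; exact: subgroupV.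
(* The second coset is nonempty: transitivity is applied with [K] equal to [G], where one swap
   provides each required replacement. *)
have [t Gt tY] : exists2 t : homeo X, G t & t @` Y = Y'.
  apply: (replacement_transitive G_group G_group O_swaps _ Y_finite YO) => //.
  - by move=> g; exact: image_homeo_orbit.
  - by move=> g [].
  - move=> y y' Yy Oy' nYy'.
    have [t [Gt ty _ tid]] := O_swaps (YO Yy) Oy' Y_finite.
    by exists t => //; exact: image_swap.
  - by move=> z [].
have -> : [set [set (g * h)%g | h in stabilizer G Y] | g in stabilizer2 G Y Y']
    = [set C Y; C Y'].
  apply/seteqP; split=> [_ [g /stabilizer2E[Gg gY] <-]|_ [->|->]].
  - by rewrite cosetE//; case: gY => ->; [left|right].
  - exists 1%g; last by rewrite cosetE ?image_id//; exact: subgroup1.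
    exact: subgroup1 stabilizer2_subgroup.
  - exists t; last by rewrite cosetE// tY.
    by apply/stabilizer2E; split=> //; right.
have CYY' : C Y != C Y'.
  apply/eqP => CYY'; have : C Y 1%g.
    by split; [exact: subgroup1|rewrite image_id].
  by rewrite CYY' => -[_]; rewrite image_id.
have -> : [set C Y; C Y'] = [set` [fset C Y; C Y']%fset].
  apply/seteqP; split=> Z /=; rewrite !inE.
    by move=> [->|->]; rewrite eqxx ?orbT.
  by move=> /orP[]/eqP->; [left|right].
by apply/card_eq_fsetP; rewrite cardfs2 CYY'.
Qed.

End Half.

Theorem theorem6p11 (R : realType) (X : topologicalType)
    (X_totally_disconnected : totally_disconnected [set: X])
    (X_compact : compact [set: X])
    (X_metrizable : metrizable R X)
    (G : set (homeo X)) (G_group : is_subgroup G) (G_ample : ample G)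
    (Y : set X) (Y_finite : finite_set Y) (Y_nonempty : Y !=set0) :
  [/\ (* (i) *)
      forall x : X,
        Y `<` homeo_orbit G x -> ~ has_half_of Y (homeo_orbit G x) ->
        maximal_subgroup (stabilizer G Y) G,
      (* (ii) *)
      forall x : X,
        Y `<=` homeo_orbit G x -> has_half_of Y (homeo_orbit G x) ->
        [/\ subgroup_of_index (stabilizer G Y)
              (stabilizer2 G Y (homeo_orbit G x `\` Y)) 2,
            ~ (exists y, Y = [set y]) ->
              maximal_subgroup (stabilizer2 G Y (homeo_orbit G x `\` Y)) G
          & (exists y, Y = [set y]) ->
              stabilizer2 G Y (homeo_orbit G x `\` Y) = G],
      (* (iii) *)
      (exists x1 x2 : X,
        [/\ homeo_orbit G x1 <> homeo_orbit G x2,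
            homeo_orbit G x1 `&` Y !=set0, ~ (homeo_orbit G x1 `<=` Y),
            homeo_orbit G x2 `&` Y !=set0 & ~ (homeo_orbit G x2 `<=` Y)]) ->
        [/\ is_subgroup (stabilizer G Y), stabilizer G Y `<` G
          & ~ maximal_subgroup (stabilizer G Y) G],
      (* (iv) *)
      union_of_orbits G Y -> stabilizer G Y = G
    & (* (v) *)
      forall Y1 Y2 : set X,
        Y = Y1 `|` Y2 -> Y1 `&` Y2 = set0 -> union_of_orbits G Y2 ->
        stabilizer G Y = stabilizer G Y1].
Proof.
have X_hausdorff := metrizable_hausdorff X_metrizable.
have X_zd := totally_disconnected_zero_dimensional X_hausdorff X_compact
  X_totally_disconnected.
(* These swaps carry everything the five statements take from the topology of [X] and from
   ampleness. *)
have G_swaps x : has_swaps G (homeo_orbit G x) by exact: orbit_has_swaps.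
split.
- by move=> x; exact: stabilizer_maximal.
- move=> x YO Y_half; split.
  + exact: stabilizer_index2.
  + exact: stabilizer2_maximal.
  + by move=> [y]; exact: stabilizer2_singleton.
- move=> [x1 [x2 [O12 O1Y nO1Y O2Y nO2Y]]]; split.
  + exact: stabilizer_subgroup.
  + exact: (stabilizer_proper G_swaps O1Y nO1Y).
  + exact: (stabilizer_not_maximal G_group G_swaps Y_finite O12).
- exact: stabilizer_union_of_orbits.
- by move=> Y1 Y2 ->; exact: stabilizer_setU_orbits.
Qed.
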